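(* There exist a countable Markov map $T$ with inverse branches $(f_i)_{i\in\mathbb N}$ and a sequence of countable Markov maps $T_k$, $k\in\mathbb N$, with inverse branches $(f_{i,k})_{i\in\mathbb N}$ of the same orientation as $T$, such that (0) $-\log|T'|$ has summable variations; (1) there exists $0<t<1$ with $\sum_{i=1}^\infty|f_i[0,1]|^t<\infty$; (2) $\sup_{k\in\mathbb N}\sum_{n=1}^\infty\mathrm{var}_n(-\log|T_k'|)<\infty$; (3) for every $i\in\mathbb N$, $f_{i,k}\to f_i$ pointwise on $[0,1]$ as $k\to\infty$; and such that the Hölder exponents $\kappa(\theta_k)$ of the topological conjugacies $\theta_k$ between $T_k$ and $T$ satisfy $$\lim_{k\to\infty}\kappa(\theta_k)=0 .$$
   Context: A countable Markov map $T:[0,1]\to[0,1]$ is given by inverse branches $f_i:[0,1]\to[0,1]$, $i\in\mathbb N=\{1,2,\dots\}$, which are $C^1$ and strictly monotone, and satisfy one of the following two conditions (the orientation): - decreasing case: all $f_i$ are strictly decreasing, $f_1(0)=1$, $f_{i+1}(0)=f_i(1)$ for all $i$, and $f_i(0)$ decreases to $0$ as $i\to\infty$; - increasing case: all $f_i$ are strictly increasing, $f_1(1)=1$, $f_{i+1}(1)=f_i(0)$ for all $i$, and $f_i(1)$ decreases to $0$ as $i\to\infty$. Moreover there exist $m\in\mathbb N$ and $\xi<1$ (depending on $T$) with $|(f_{i_1}\circ\cdots\circ f_{i_m})'(x)|\le\xi$ for all $(i_1,\dots,i_m)\in\mathbb N^m$ and $x\in(0,1)$. The map is $T(x)=f_i^{-1}(x)$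 for $x\in f_i([0,1))$ and $T(0)=0$ (and $T(1)=1$ in the increasing case). $|f_i[0,1]|$ is the length of the interval $f_i([0,1])$. Let $\Sigma=\mathbb N^{\mathbb N}$ with left shift $\sigma$, let $[\mathbf i]\subset\Sigma$ be the cylinder of sequences starting with the finite word $\mathbf i$, and let $\pi_T(i_1,i_2,\dots)=\lim_{n\to\infty}f_{i_1}\circ\cdots\circ f_{i_n}(0)$. The potential $-\log|T'|$ is regarded as the function on $\Sigma$ given by $\phi(\mathbf i)=-\log|T'(\pi_T(\mathbf i))|=\log|f_{i_1}'(\pi_T(\sigma\mathbf i))|$ (assumed finite). For $n\ge1$, $\mathrm{var}_n(\phi)=\sup_{\mathbf i\in\mathbb N^n}\sup\{|\phi(\mathbf j)-\phi(\mathbf k)|:\mathbf j,\mathbf k\in[\mathbf i]\}$, and $\phi$ has summable variations if $\sum_{n\ge1}\mathrm{var}_n(\phi)<\infty$. The topological conjugacy $\theta_k$ between $T_k$ and $T$ is the increasing homeomorphism of $[0,1]$ with $T\circ\theta_k=\theta_k\circ T_k$ that matches codings: $\theta_k\circ\pi_{T_k}=\pi_T$ on $\Sigma$, equivalently $\theta_k\circ f_{i,k}=f_i\circ\theta_k$ for all $i$. The Hölder exponent $\kappa(\theta)$ of $\theta:[0,1]\to[0,1]$ is the supremum of the $\kappa\ge0$ for which there is $C>0$ with $|\theta(x)-\theta(y)|\le C|x-y|^\kappa$ for all $x,y\in[0,1]$. *)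

(* Defs.v *)
From HB Require Import structures.
From mathcomp Require Import all_boot all_order all_algebra.
From mathcomp Require Import all_classical all_reals all_analysis.
Import Order.TTheory GRing.Theory Num.Theory.
Import numFieldNormedType.Exports.

Set Implicit Arguments.
Unset Strict Implicit.
Unset Printing Implicit Defensive.

Local Open Scope classical_set_scope.
Local Open Scope ring_scope.

(* Self-maps of [0,1] are total functions R -> R whose values outside [0,1]
   are irrelevant.  Branches are indexed by nat: [f i] is the (i+1)-st branch. *)

Section Defs.
Variable R : realType.

(* One-sided at the endpoints of [0,1]. *)
Definition diffq01 (f : R -> R) (x : R) : set_system R :=
  (fun y => (f y - f x) / (y - x)) @ within `[0, 1] (x^').

Definition derive01 (f : R -> R) (x : R) : R := lim (diffq01 f x).

Definition C1_01 (f : R -> R) : Prop :=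
  (forall x : R, x \in `[0, 1] -> cvg (diffq01 f x)) /\
  {within `[0, 1], continuous (derive01 f)}.

Definition word_branch (f : nat -> R -> R) (w : seq nat) : R -> R :=
  foldr (fun i g => f i \o g) id w.

Inductive orientation := Decreasing | Increasing.

Definition oriented (o : orientation) (f : nat -> R -> R) : Prop :=
  match o with
  | Decreasing =>
      [/\ forall i, {in `[0, 1] &, {homo f i : x y / x < y >-> y < x}},
          f 0%N 0 = 1,
          forall i, f i.+1 0 = f i 1,
          decreasing_seq (fun i => f i 0)
        & (fun i => f i 0) @ \oo --> (0 : R)]
  | Increasing =>
      [/\ forall i, {in `[0, 1] &, {homo f i : x y / x < y}},
          f 0%N 1 = 1,
          forall i, f i.+1 1 = f i 0,
          decreasing_seq (fun i => f i 1)
        & (fun i => f i 1) @ \oo --> (0 : R)]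
  end.

Record countable_markov_map (o : orientation) (T : R -> R)
    (f : nat -> R -> R) : Prop := CountableMarkovMap {
  branch01 : forall i (x : R), x \in `[0, 1] -> f i x \in `[0, 1];
  branchC1 : forall i, C1_01 (f i);
  branch_oriented : oriented o f;
  branch_contract : exists (m : nat) (xi : R),
    [/\ (0 < m)%N, xi < 1 &
        forall (w : m.-tuple nat) (x : R), x \in `]0, 1[ ->
          `|derive1 (word_branch f w) x| <= xi];
  markov_branch : forall i (x : R), x \in `[0, 1[ -> T (f i x) = x;
  markov0 : T 0 = 0;
  markov1 : o = Increasing -> T 1 = 1 }.

Definition sigma_shift (s : nat -> nat) : nat -> nat := fun n => s n.+1.

Definition cylinder (w : seq nat) : set (nat -> nat) :=
  [set s | mkseq s (size w) = w].

Definition coding (f : nat -> R -> R) (s : nat -> nat) : R :=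
  lim ((fun n => word_branch f (mkseq s n) 0) @ \oo).

(* - log |T'| on the symbolic space.  The derivative is that of the branch
   selected by the first symbol, as T has no two-sided derivative at the
   endpoints of the intervals f_i([0,1]). *)
Definition potential (f : nat -> R -> R) (s : nat -> nat) : R :=
  ln `|derive01 (f (s 0%N)) (coding f (sigma_shift s))|.

(* Excludes the default value ln 0 = 0. *)
Definition potential_finite (f : nat -> R -> R) : Prop :=
  forall s, derive01 (f (s 0%N)) (coding f (sigma_shift s)) != 0.

Definition symbolic_var (n : nat) (phi : (nat -> nat) -> R) : \bar R :=
  ereal_sup [set ereal_sup [set `|phi p.1 - phi p.2|%:E
                           | p in cylinder w `*` cylinder w]
            | w in [set: n.-tuple nat]].

Definition symbolic_var_sum (phi : (nat -> nat) -> R) : \bar R :=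
  (\sum_(1 <= n <oo) symbolic_var n phi)%E.

Definition summable_variations (phi : (nat -> nat) -> R) : Prop :=
  (symbolic_var_sum phi < +oo)%E.

Definition increasing_homeo01 (theta : R -> R) : Prop :=
  {in `[0, 1] &, {homo theta : x y / x < y}} /\
  exists eta : R -> R,
    [/\ forall x : R, x \in `[0, 1] ->
          theta x \in `[0, 1] /\ eta x \in `[0, 1],
        {in `[0, 1], cancel theta eta},
        {in `[0, 1], cancel eta theta},
        {within `[0, 1], continuous theta}
      & {within `[0, 1], continuous eta}].

(* theta is the conjugacy from (S, g) to (T, f). *)
Definition conjugacy (S : R -> R) (g : nat -> R -> R)
    (T : R -> R) (f : nat -> R -> R) (theta : R -> R) : Prop :=
  [/\ increasing_homeo01 theta,
      forall x : R, x \in `[0, 1] -> T (theta x) = theta (S x)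
    & forall s, theta (coding g s) = coding f s].

Definition holder_exponent (theta : R -> R) : \bar R :=
  ereal_sup [set kappa%:E | kappa in [set kappa : R | 0 <= kappa /\
    exists2 C : R, 0 < C & forall x y : R, x \in `[0, 1] -> y \in `[0, 1] ->
      `|theta x - theta y| <= C * `|x - y| `^ kappa]].

End Defs.

(* Main.v *)
(** Both systems are piecewise affine with increasing branches, so each potential
    depends on the first symbol only and all its variations vanish.  [T] has the
    breakpoints [2 ^ - n]; [T_k] differs from it in the single breakpoint [k + 1],
    moved so that the slope [p = 2 ^ - (k + 2)] of the branch [k + 1] becomes
    [p ^ (k + 1)].  For each fixed branch the convergence is therefore eventually
    constant.

    The left endpoints [f_w(0)] of the cylinders are dense in [0,1], and their
    order is a lexicographic order on the words [w], hence the same for all such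
    systems.  Matching Dedekind cuts of these endpoints gives the conjugacy.

    [theta_k] maps intervals of length about [p ^ ((k + 1) n)] (the cylinders of
    the words repeating the symbol [k + 1]) to intervals of length about [p ^ n],
    so its Hoelder exponent is at most [1 / (k + 1)]. *)

Require Import Defs.
From HB Require Import structures.
From mathcomp Require Import all_boot all_order all_algebra.
From mathcomp Require Import all_classical all_reals all_analysis.
From mathcomp Require Import ring lra.
Import Order.TTheory GRing.Theory Num.Theory.
Import numFieldNormedType.Exports.

Local Open Scope classical_set_scope.
Local Open Scope ring_scope.

(** * Piecewise affine systems given by breakpoints *)

Record partition_points {R : realType} (a : nat -> R) : Prop := {
  points0 : a 0%N = 1;
  points_gt : forall n, a n.+1 < a n;
  points_cvg : a @ \oo --> (0 : R) }.

Definition affine_branch {R : realType} (a : nat -> R) (i : nat) (x : R) : R :=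
  a i.+1 + (a i - a i.+1) * x.

(* The default value [y] of [xget] makes the map fix 0 and 1. *)
Definition affine_map {R : realType} (a : nat -> R) (y : R) : R :=
  xget y [set x | 0 <= x < 1 /\ exists i, affine_branch a i x = y].

Definition word_point {R : realType} (a : nat -> R) (w : seq nat) : R :=
  word_branch (affine_branch a) w 0.

(* Larger symbols give intervals further to the left. *)
Fixpoint word_lt (w v : seq nat) : bool :=
  match w, v with
  | _, [::] => false
  | [::], _ :: _ => true
  | i :: w', j :: v' => (j < i)%N || (i == j) && word_lt w' v'
  end.

(** Carries the cut that [x] makes in the endpoints for [a] over to those for [b]. For [x >= 0] the
    empty word, whose endpoint is 0, keeps the set nonempty, so [sup] is a genuine supremum. *)
Definition transfer {R : realType} (a b : nat -> R) (x : R) : R :=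
  sup [set word_point b w | w in [set w | word_point a w <= x]].

Section OnePartition.
Variables (R : realType) (a : nat -> R).
Hypothesis Pa : partition_points a.
Implicit Types (x y : R) (i j n : nat) (w v : seq nat) (s : nat -> nat).
Local Notation f := (affine_branch a).

Lemma points_le i j : (i <= j)%N -> a j <= a i.
Proof.
move=> /subnK <-; elim: (j - i)%N => [|n IH] //=.
by rewrite addSn (le_trans _ IH)// ltW// (points_gt _ Pa).
Qed.

Lemma points_gt0 n : 0 < a n.
Proof.
apply: le_lt_trans (points_gt _ Pa n).
rewrite -(cvg_lim (@Rhausdorff R) (points_cvg _ Pa)).
apply: limr_le; first by apply/cvg_ex; exists 0; exact: points_cvg.
by near=> m; apply: points_le; near: m; exists n.+1.
Unshelve. all: by end_near. Qed.

Lemma points_le1 n : a n <= 1.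
Proof. by rewrite -(points0 _ Pa) points_le. Qed.

Lemma slope_gt0 i : 0 < a i - a i.+1.
Proof. by rewrite subr_gt0 (points_gt _ Pa). Qed.

(** Branch 0 has slope [1 - a 1] and all other branch intervals lie in [0, a 1]. Uniformity in [i]
    serves both the density of endpoints and the contraction condition. *)
Lemma slope_contract : exists2 r : R, 0 < r < 1 & forall i, a i - a i.+1 <= r.
Proof.
have a1 := points_gt0 1; have := points_gt _ Pa 0; rewrite (points0 _ Pa) => a1'.
exists (Num.max (1 - a 1%N) (a 1%N)).
  by rewrite lt_max gt_max a1 a1' orbT ltrBlDr ltrDl a1.
case=> [|i]; first by rewrite (points0 _ Pa) le_max lexx.
rewrite le_max; apply/orP; right.
by rewrite lerBlDr (le_trans (points_le 1 i.+1 _))// lerDl ltW// points_gt0.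
Qed.

Lemma points_locate x : 0 < x < 1 -> exists i, a i.+1 <= x < a i.
Proof.
move=> /andP[x0 x1].
have ex : exists n, a n <= x.
  have : \forall n \near \oo, a n < x.
    exact: (cvgr_lt _ (points_cvg _ Pa)).
  by case=> N _ /(_ N (leqnn N)) /ltW; exists N.
case: (ex_minnP ex) => -[|n]; first by rewrite (points0 _ Pa) leNgt x1.
move=> le_n min_n; exists n; rewrite le_n ltNge.
by apply/negP => /min_n; rewrite ltnn.
Qed.

Lemma affine_branch_mono i : {mono f i : x y / x <= y}.
Proof. by move=> x y; rewrite lerD2l ler_pM2l// slope_gt0. Qed.

Lemma affine_branch_mono_lt i : {mono f i : x y / x < y}.
Proof. exact/leW_mono/affine_branch_mono. Qed.

Lemma affine_branch0 i : f i 0 = a i.+1.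
Proof. by rewrite /affine_branch mulr0 addr0. Qed.

Lemma affine_branch1 i : f i 1 = a i.
Proof. by rewrite /affine_branch mulr1 addrC subrK. Qed.

Lemma affine_branch_ge i x : 0 <= x -> a i.+1 <= f i x.
Proof. by move=> ?; rewrite -affine_branch0 affine_branch_mono. Qed.

Lemma affine_branch_lt i x : x < 1 -> f i x < a i.
Proof. by move=> ?; rewrite -affine_branch1 affine_branch_mono_lt. Qed.

(** The breakpoint [a i], which is at most [a j.+1], separates the two images. Hence distinct
    branches send [0,1) to disjoint sets. *)
Lemma affine_branch_lt_index i j x y :
  (j < i)%N -> x < 1 -> 0 <= y -> f i x < f j y.
Proof.
move=> ji x1 y0; apply: lt_le_trans (affine_branch_ge _ _ y0).
exact: lt_le_trans (affine_branch_lt _ _ x1) (points_le _ _ ji).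
Qed.

Lemma affine_branch_itvco i x : 0 <= x < 1 -> 0 <= f i x < 1.
Proof.
move=> /andP[x0 x1]; apply/andP; split.
  exact/ltW/(lt_le_trans (points_gt0 i.+1))/affine_branch_ge.
exact: lt_le_trans (affine_branch_lt _ _ x1) (points_le1 i).
Qed.

Lemma affine_branch_itvcc i x : 0 <= x <= 1 -> 0 <= f i x <= 1.
Proof.
move=> /andP[x0 x1]; apply/andP; split.
  exact/ltW/(lt_le_trans (points_gt0 i.+1))/affine_branch_ge.
by apply: le_trans (points_le1 i); rewrite -affine_branch1 affine_branch_mono.
Qed.

Lemma affine_branch_surj x : 0 < x < 1 -> exists i y, 0 <= y < 1 /\ f i y = x.
Proof.
move=> /points_locate [i /andP[ax xa]]; have s0 := slope_gt0 i.
exists i, ((x - a i.+1) / (a i - a i.+1)); split.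
  apply/andP; split; first by apply: divr_ge0; [rewrite subr_ge0|exact: ltW].
  by rewrite ltr_pdivrMr// mul1r ltrD2r.
by rewrite /affine_branch mulrCA divff ?gt_eqF// mulr1 addrC subrK.
Qed.

Lemma affine_mapK i x : 0 <= x < 1 -> affine_map a (f i x) = x.
Proof.
move=> x01; rewrite /affine_map.
case: xgetP => [y _ [] | /(_ x) []]; last by split=> //; exists i.
move=> y01 [j].
have /andP[x0 x1] := x01; have /andP[y0 y1] := y01.
case: (ltngtP i j) => [ij|ji|->] e.
- by have := affine_branch_lt_index _ _ _ _ ij y1 x0; rewrite e ltxx.
- by have := affine_branch_lt_index _ _ _ _ ji x1 y0; rewrite e ltxx.
- by apply: (inc_inj (affine_branch_mono j)).
Qed.

Lemma affine_map0 : affine_map a 0 = 0.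
Proof.
rewrite /affine_map; case: xgetP => // y _ [] /andP[y0 _] [i e].
by have := affine_branch_ge i _ y0; rewrite e leNgt points_gt0.
Qed.

Lemma affine_map1 : affine_map a 1 = 1.
Proof.
rewrite /affine_map; case: xgetP => // y _ [] y01 [i e].
by have /andP[] := affine_branch_itvco i _ y01; rewrite e ltxx.
Qed.

(** * Order and density of cylinder endpoints, and the coding map *)

Lemma word_point_itv w : 0 <= word_point a w < 1.
Proof.
elim: w => [|i w IH]; first by rewrite /word_point/= lexx ltr01.
exact: affine_branch_itvco.
Qed.

(** Different first symbols give disjoint ordered intervals, equal ones reduce to the tails, and a
    nonempty word has a positive endpoint. The right side does not mention [a], which is what makes
    systems comparable. *)
Lemma word_point_lt w v : (word_point a w < word_point a v) = word_lt w v.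
Proof.
elim: w v => [|i w IH] [|j v] /=.
- exact: ltxx.
- have /andP[v0 _] := word_point_itv v.
  exact: lt_le_trans (points_gt0 _) (affine_branch_ge j _ v0).
- by apply/negbTE; rewrite -leNgt; have /andP[] := word_point_itv (i :: w).
have /andP[v0 v1] := word_point_itv v; have /andP[w0 w1] := word_point_itv w.
rewrite /word_point/= -!/(word_point a _).
case: ltngtP => [ij|ji|<-] /=.
- exact: affine_branch_lt_index.
- by apply/negbTE; rewrite -leNgt ltW// affine_branch_lt_index.
- by rewrite affine_branch_mono_lt IH.
Qed.

(* Either some breakpoint separates [x] from [y], or both lie in one branch
   interval, on which the inverse branch stretches [y - x] by at least [1 / r]. *)
Lemma word_point_dense x y :
  0 <= x -> x < y -> y <= 1 -> exists w, x < word_point a w < y.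
Proof.
have [r /andP[r0 r1] slope_le] := slope_contract.
move=> x0 xy y1.
have [n] : exists n, r ^+ n <= y - x.
  have d0 : 0 < y - x by rewrite subr_gt0.
  have : \forall n \near \oo, r ^+ n < y - x.
    by apply: (cvgr_lt _ (cvg_expr _)) => //; rewrite ger0_norm// ltW.
  by case=> N _ /(_ N (leqnn N)) /ltW; exists N.
elim: n x y x0 xy y1 => [|n IH] x y x0 xy y1 hn.
  (* Length at least 1 forces [x = 0] and [y = 1], so [a 1] lies strictly between. *)
  exists [:: 0%N]; rewrite /word_point/= affine_branch0.
  have := points_gt0 1; have := points_gt _ Pa 0; rewrite (points0 _ Pa).
  by move: hn; rewrite expr0; lra.
have [[j /andP[xj jy]]|noj] := pselect (exists j, x < a j.+1 < y).
  by exists [:: j]; rewrite /word_point/= affine_branch0 xj.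
(* At 0 the breakpoints accumulate, so one of them would fall below [y]. *)
have {}x0 : 0 < x.
  rewrite lt_neqAle x0 andbT; apply/eqP => xe; apply: noj.
  have : \forall n \near \oo, a n < y.
    by apply: (cvgr_lt _ (points_cvg _ Pa)); rewrite xe.
  by case=> N _ /(_ N.+1 (leqnSn N)) /= ay; exists N; rewrite -xe points_gt0.
have xlt1 : 0 < x < 1 by rewrite x0 (lt_le_trans xy).
have [i /andP[ax xa]] := points_locate _ xlt1; have s0 := slope_gt0 i.
(* [noj] only covers positive indices; for [i = 0] the bound is [y <= 1]. *)
have ya : y <= a i.
  case: i xa {ax s0} => [|i] xa; first by rewrite (points0 _ Pa).
  by rewrite leNgt; apply/negP => ay; apply: noj; exists i; rewrite xa.
pose x' := (x - a i.+1) / (a i - a i.+1); pose y' := (y - a i.+1) / (a i - a i.+1).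
have fx : f i x' = x.
  by rewrite /affine_branch mulrCA divff ?gt_eqF// mulr1 addrC subrK.
have fy : f i y' = y.
  by rewrite /affine_branch mulrCA divff ?gt_eqF// mulr1 addrC subrK.
case: (IH x' y').
- by apply: divr_ge0; [rewrite subr_ge0|exact: ltW].
- by rewrite -(affine_branch_mono_lt i) fx fy.
- by rewrite -(affine_branch_mono i) fy affine_branch1.
- rewrite -mulrBl opprB addrA subrK ler_pdivlMr//; apply: le_trans hn.
  by rewrite exprS mulrC ler_wpM2r// exprn_ge0// ltW.
move=> w; exists (i :: w); rewrite /word_point/= -/(word_point a w).
by rewrite -{1}fx -{1}fy !affine_branch_mono_lt.
Qed.

(** Lengthening the empty word raises the endpoint from 0; the increasing branches of the common
    prefix preserve this. *)
Lemma word_point_mkseq_le s : {homo (fun n => word_point a (mkseq s n)) : n m /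
  (n <= m)%N >-> n <= m}.
Proof.
apply/nondecreasing_seqP => n; elim: n s => [|n IH] s.
  by case/andP: (word_point_itv (mkseq s 1)).
have e m : mkseq s m.+1 = s 0%N :: mkseq (fun n => s n.+1) m.
  by rewrite /mkseq/= (iotaDl 1) -map_comp.
by rewrite !e /word_point/= -!/(word_point a _) affine_branch_mono IH.
Qed.

Lemma cvg_word_point s : cvgn (fun n => word_point a (mkseq s n)).
Proof.
apply: nondecreasing_is_cvgn; first exact: word_point_mkseq_le.
by exists 1 => _ [n _ <-]; apply/ltW; case/andP: (word_point_itv (mkseq s n)).
Qed.

Lemma word_point_le_coding s n : word_point a (mkseq s n) <= coding f s.
Proof.
exact: (nondecreasing_cvgn_le (word_point_mkseq_le s) (cvg_word_point s)).
Qed.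

Lemma coding_le s y : (forall n, word_point a (mkseq s n) <= y) -> coding f s <= y.
Proof. by move=> ?; apply: limr_le; [exact: cvg_word_point|exact: nearW]. Qed.

Lemma coding_itv s : 0 <= coding f s <= 1.
Proof.
apply/andP; split; first exact: (word_point_le_coding s 0).
by apply: coding_le => n; apply/ltW; case/andP: (word_point_itv (mkseq s n)).
Qed.

(** Composing branch [i] with itself [n] times scales differences by the slope to the [n]; this
    gives the interval lengths in the Hoelder estimate. *)
Lemma word_point_nseq n i w :
  word_point a (nseq n i ++ w) - word_point a (nseq n i) =
  (a i - a i.+1) ^+ n * word_point a w.
Proof.
elim: n => [|n IH]; first by rewrite expr0 mul1r /word_point/= subr0.
rewrite /word_point/= -!/(word_point a _) exprS -mulrA -IH /affine_branch; ring.
Qed.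

End OnePartition.

(** * Transfer between two partitions by matching cuts *)

Section TwoPartitions.
Variables (R : realType) (a b : nat -> R).
Hypotheses (Pa : partition_points a) (Pb : partition_points b).
Implicit Types (x y : R) (i n : nat) (w v : seq nat) (s : nat -> nat).

(** By density an endpoint separates any two distinct points. *)
Lemma cut_inj x y : 0 <= x <= 1 -> 0 <= y <= 1 ->
  (forall w, (word_point a w <= x) = (word_point a w <= y)) -> x = y.
Proof.
move=> /andP[x0 x1] /andP[y0 y1] e; case: (ltgtP x y) => // lt.
- have [w /andP[xw wy]] := word_point_dense _ _ Pa _ _ x0 lt y1.
  by have := e w; rewrite (ltW wy) leNgt xw.
- have [w /andP[yw wx]] := word_point_dense _ _ Pa _ _ y0 lt x1.
  by have := e w; rewrite (ltW wx) leNgt yw.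
Qed.

Lemma word_point_le w v :
  (word_point a w <= word_point a v) = (word_point b w <= word_point b v).
Proof. by rewrite !leNgt !word_point_lt. Qed.

Lemma le_transfer x w : word_point a w <= x -> word_point b w <= transfer a b x.
Proof.
move=> wx; apply: ub_le_sup; last by exists w.
by exists 1 => _ [v _ <-]; apply/ltW; case/andP: (word_point_itv _ _ Pb v).
Qed.

Lemma transfer_itv x : 0 <= x -> 0 <= transfer a b x <= 1.
Proof.
move=> x0; apply/andP; split; first exact: (le_transfer x [::]).
apply: ge_sup; first by exists (word_point b [::]), [::].
by move=> _ [v _ <-]; apply/ltW; case/andP: (word_point_itv _ _ Pb v).
Qed.

Lemma transfer_cut x w : 0 <= x ->
  (word_point a w <= x) = (word_point b w <= transfer a b x).
Proof.
move=> x0; apply/idP/idP; first exact: le_transfer.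
apply: contraTT; rewrite -!ltNge => xw.
have /andP[_ /ltW w1] := word_point_itv _ _ Pa w.
(* The intermediate endpoint of [v] bounds the supremum and keeps it strictly below the endpoint of
   [w]. *)
have [v /andP[xv vw]] := word_point_dense _ _ Pa _ _ x0 xw w1.
apply: (@le_lt_trans _ _ (word_point b v)).
  2: by rewrite word_point_lt // -(word_point_lt _ a).
apply: ge_sup; first by exists (word_point b [::]), [::].
move=> _ [u /= ux <-]; rewrite -word_point_le.
exact/ltW/(le_lt_trans ux).
Qed.

End TwoPartitions.

Section Transfer.
Variables (R : realType) (a b : nat -> R).
Hypotheses (Pa : partition_points a) (Pb : partition_points b).
Implicit Types (x y : R) (i n : nat) (w v : seq nat) (s : nat -> nat).

(** The tool for evaluating [transfer]: a value is identified by its cut alone. *)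
Lemma transferP x y : 0 <= x -> 0 <= y <= 1 ->
  (forall w, (word_point a w <= x) = (word_point b w <= y)) ->
  transfer a b x = y.
Proof.
move=> x0 y01 e; apply: (cut_inj _ _ Pb) => //; first exact: transfer_itv.
by move=> w; rewrite -(transfer_cut _ a b Pa Pb).
Qed.

Lemma transfer0 : transfer a b 0 = 0.
Proof.
by apply: transferP => [||w]; rewrite ?lexx ?ler01// (word_point_le _ _ _ Pa Pb w [::]).
Qed.

Lemma transfer1 : transfer a b 1 = 1.
Proof.
apply: transferP => [||w]; rewrite ?lexx ?ler01//.
have /andP[_ /ltW ->] := word_point_itv _ _ Pa w.
by have /andP[_ /ltW ->] := word_point_itv _ _ Pb w.
Qed.

Lemma transfer_word_point w : transfer a b (word_point a w) = word_point b w.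
Proof.
have /andP[wa _] := word_point_itv _ _ Pa w.
have /andP[wb1 /ltW wb2] := word_point_itv _ _ Pb w.
by apply: transferP => [||v]; rewrite ?wb1// (word_point_le _ _ _ Pa Pb).
Qed.

Lemma transferK x : 0 <= x <= 1 -> transfer b a (transfer a b x) = x.
Proof.
move=> /andP[x0 x1]; have /andP[t0 t1] := transfer_itv _ a b Pb _ x0.
apply: (cut_inj _ _ Pa); rewrite ?x0 ?transfer_itv// => w.
by rewrite -(transfer_cut _ b a Pb Pa)// -(transfer_cut _ a b Pa Pb).
Qed.

Lemma transfer_homo x y : 0 <= x -> x <= y -> transfer a b x <= transfer a b y.
Proof.
move=> x0 xy; apply: ge_sup; first by exists (word_point b [::]), [::].
by move=> _ [w wx <-]; apply: le_transfer => //; exact: le_trans xy.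
Qed.

(** The cuts of both sides are compared on words [j :: w]: for [j] different from [i] the order of
    the branches decides, and for [j = i] monotonicity reduces to the cut of [x]. *)
Lemma transfer_affine_branch i x : 0 <= x < 1 ->
  transfer a b (affine_branch a i x) = affine_branch b i (transfer a b x).
Proof.
move=> /andP[x0 x1]; have /andP[t0 t1] := transfer_itv _ a b Pb _ x0.
(* Ordering the images of different branches requires arguments below 1; an endpoint between [x] and
   1 carries this bound over. *)
have {}t1 : transfer a b x < 1.
  have [w /andP[xw w1]] := word_point_dense _ _ Pa _ _ x0 x1 (lexx 1).
  apply: (@lt_trans _ _ (word_point b w)).
    by rewrite ltNge -(transfer_cut _ a b Pa Pb)// -ltNge.
  by case/andP: (word_point_itv _ _ Pb w).
have x01 : 0 <= x < 1 by rewrite x0.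
have t01 : 0 <= transfer a b x < 1 by rewrite t0.
have /andP[fx0 fx1] := affine_branch_itvco _ _ Pa i _ x01.
have /andP[ft0 ft1] := affine_branch_itvco _ _ Pb i _ t01.
apply: transferP => //; first by rewrite ft0 ltW.
case=> [|j w]; first by rewrite /word_point/= fx0 ft0.
have /andP[wa0 wa1] := word_point_itv _ _ Pa w.
have /andP[wb0 wb1] := word_point_itv _ _ Pb w.
rewrite /word_point/= -!/(word_point _ _).
case: (ltngtP i j) => [ij|ji|->].
- by rewrite !ltW ?affine_branch_lt_index.
- by rewrite !leNgt !affine_branch_lt_index.
- by rewrite !affine_branch_mono// (transfer_cut _ a b Pa Pb).
Qed.

(** Points of (0,1) are branch images of points of [0,1); the points 0 and 1 are fixed by all maps
    involved. *)
Lemma transfer_affine_map x : 0 <= x <= 1 ->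
  affine_map b (transfer a b x) = transfer a b (affine_map a x).
Proof.
move=> /andP[]; rewrite le_eqVlt => /predU1P[<- _|x0].
  by rewrite affine_map0// !transfer0 affine_map0.
rewrite le_eqVlt => /predU1P[->|x1].
  by rewrite affine_map1// !transfer1 affine_map1.
have x01 : 0 < x < 1 by rewrite x0.
have [i [y [y01 <-]]] := affine_branch_surj _ _ Pa _ x01.
rewrite transfer_affine_branch// !affine_mapK//.
have /andP[y0 y1] := y01; have /andP[-> _] := transfer_itv _ a b Pb _ y0.
have [w /andP[yw w1]] := word_point_dense _ _ Pa _ _ y0 y1 (lexx 1).
apply: (@lt_trans _ _ (word_point b w)).
  by rewrite ltNge -(transfer_cut _ a b Pa Pb)// -ltNge.
by case/andP: (word_point_itv _ _ Pb w).
Qed.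

Lemma coding_le_transfer s :
  coding (affine_branch b) s <= transfer a b (coding (affine_branch a) s).
Proof.
apply: (coding_le _ _ Pb) => n; apply: le_transfer => //.
exact: word_point_le_coding.
Qed.

End Transfer.

(** * The transfer map as a conjugacy *)

Section Conjugacy.
Variables (R : realType) (a b : nat -> R).
Hypotheses (Pa : partition_points a) (Pb : partition_points b).

(** The upper bound is [coding_le_transfer] with the partitions exchanged, pushed forward by the
    monotone map [transfer a b], which undoes [transfer b a]. *)
Lemma transfer_coding s :
  transfer a b (coding (affine_branch a) s) = coding (affine_branch b) s.
Proof.
apply/eqP; rewrite eq_le; apply/andP; split; last exact: coding_le_transfer.
have cb := coding_itv _ _ Pb s; rewrite -(transferK _ b a Pb Pa _ cb).
apply: transfer_homo => //; last exact: coding_le_transfer.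
by have /andP[] := coding_itv _ _ Pa s.
Qed.

Lemma transfer_mono : {in `[0, 1] &, {mono transfer a b : x y / x <= y}}.
Proof.
apply: le_mono_in => x y; rewrite !in_itv/= => x01 y01 xy.
have /andP[x0 _] := x01; have /andP[y0 _] := y01.
rewrite lt_neqAle; apply/andP; split; last by apply: transfer_homo => //; exact: ltW.
apply/eqP => e.
by move: xy; rewrite -(transferK _ _ _ Pa Pb _ x01) e (transferK _ _ _ Pa Pb) ?ltxx.
Qed.

End Conjugacy.

(** An increasing map onto a segment has no jumps; the reverse transfer provides preimages. *)
Lemma transfer_continuous {R : realType} {a b : nat -> R} :
  partition_points a -> partition_points b ->
  {within `[0, 1], continuous (transfer a b)}.
Proof.
move=> Pa Pb; apply: segment_inc_surj_continuous; first exact: transfer_mono.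
rewrite transfer0// transfer1// => y /=; rewrite in_itv/= => y01.
have /andP[y0 _] := y01; exists (transfer b a y); last exact: transferK.
by rewrite /= in_itv/=; exact: transfer_itv.
Qed.

Lemma transfer_homeo {R : realType} {a b : nat -> R} :
  partition_points a -> partition_points b -> increasing_homeo01 (transfer a b).
Proof.
move=> Pa Pb; split.
  by move=> x y x01 y01; rewrite (leW_mono_in (transfer_mono _ _ _ Pa Pb)).
exists (transfer b a); split.
- move=> x; rewrite !in_itv/= => /andP[x0 _].
  by split; exact: transfer_itv.
- by move=> x; rewrite in_itv/=; exact: transferK.
- by move=> x; rewrite in_itv/=; exact: transferK.
- exact: transfer_continuous.
- exact: transfer_continuous.
Qed.

Lemma transfer_conjugacy {R : realType} {a b : nat -> R} :
  partition_points a -> partition_points b ->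
  conjugacy (affine_map a) (affine_branch a) (affine_map b) (affine_branch b)
    (transfer a b).
Proof.
move=> Pa Pb; split; first exact: transfer_homeo.
- by move=> x; rewrite in_itv/=; exact: transfer_affine_map.
- exact: transfer_coding.
Qed.

(** * Derivatives of affine branches on [0,1] *)

Lemma within01_dnbhs_proper {R : realType} (x : R) :
  0 <= x <= 1 -> ProperFilter (within `[0, 1] (x^')).
Proof.
move=> /andP[x0 x1]; split; last exact: within_filter.
(* It suffices to find a proper filter refining the punctured neighbourhoods and concentrated on
   [0,1]: the right-hand one for [x < 1], the left-hand one at 1. *)
have nonempty (s : set_system R) : ProperFilter s -> (forall A, x^' A -> s A) ->
    s (fun z => 0 <= z <= 1) -> ~ within `[0, 1] (x^') set0.
  move=> Ps sx s01 /sx empty; apply: (@filter_not_empty _ s).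
  by apply: filterS2 empty s01 => z /= h z01; apply: h; rewrite in_itv.
have [xlt|xge] := ltP x 1.
- apply: (nonempty (x^'+)).
    move=> A xA; change (nbhs x (fun z => x < z -> A z)).
    by apply: (@filterS _ (nbhs x)) xA => z /= h /gt_eqF zx; apply: h; rewrite zx.
  near=> z; apply/andP; split.
    by apply: le_trans x0 _; apply/ltW; near: z; exact: nbhs_right_gt.
  by apply/ltW; near: z; exact: nbhs_right_lt.
- have xE : x = 1 by apply/eqP; rewrite eq_le x1.
  apply: (nonempty (x^'-)).
    move=> A xA; change (nbhs x (fun z => z < x -> A z)).
    by apply: (@filterS _ (nbhs x)) xA => z /= h /lt_eqF zx; apply: h; rewrite zx.
  near=> z; apply/andP; split.
    by apply/ltW; near: z; apply: nbhs_left_gt; rewrite xE.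
  by apply: le_trans x1; apply/ltW; near: z; exact: nbhs_left_lt.
Unshelve. all: by end_near. Qed.

Section AffineCalculus.
Variables (R : realType) (a : nat -> R) (i : nat).
Local Notation f := (affine_branch a).

Lemma cvg_diffq01_affine_branch (x : R) :
  0 <= x <= 1 -> diffq01 (f i) x --> a i - a i.+1.
Proof.
move=> /within01_dnbhs_proper ?; apply: cvg_near_cst.
apply: cvg_within; near=> y.
rewrite /affine_branch opprD addrACA subrr add0r -mulrBr mulfK// subr_eq0.
by near: y; exact: nbhs_dnbhs_neq.
Unshelve. all: by end_near. Qed.

Lemma derive01_affine_branch (x : R) :
  0 <= x <= 1 -> derive01 (f i) x = a i - a i.+1.
Proof.
move=> x01; have ? := within01_dnbhs_proper x x01.
exact: cvg_lim (cvg_diffq01_affine_branch x x01).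
Qed.

Lemma C1_01_affine_branch : C1_01 (f i).
Proof.
split=> [x|]; first rewrite in_itv/= => x01.
  by apply/cvg_ex; exists (a i - a i.+1); exact: cvg_diffq01_affine_branch.
(* The value of [derive01] is known on [0,1] only, so it is replaced by the constant slope there. *)
apply: (@subspace_eq_continuous R `[0, 1]%classic R (fun=> a i - a i.+1)).
  move=> x; rewrite inE/= in_itv/= => x01.
  by rewrite /from_subspace derive01_affine_branch.
by apply: continuous_subspaceT => ?; exact: cvg_cst.
Qed.

Lemma derive1_affine_branch (x : R) : derive1 (f i) x = a i - a i.+1.
Proof.
apply: cvg_lim => //; apply: cvg_near_cst; near=> h.
rewrite /affine_branch opprD addrACA subrr add0r -mulrBr addrK.
rewrite /GRing.scale/= mulrC mulfK//.
by near: h; exact: nbhs_dnbhs_neq.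
Unshelve. all: by end_near. Qed.

End AffineCalculus.

(** * Markov property, potentials, variations and interval lengths *)

Lemma affine_markov_map {R : realType} {a : nat -> R} : partition_points a ->
  countable_markov_map Increasing (affine_map a) (affine_branch a).
Proof.
move=> Pa; split.
- by move=> i x; rewrite !in_itv/=; exact: affine_branch_itvcc.
- exact: C1_01_affine_branch.
- split.
  + by move=> i x y _ _ xy; rewrite affine_branch_mono_lt.
  + by rewrite affine_branch1 (points0 _ Pa).
  + by move=> i; rewrite affine_branch0 affine_branch1.
  + by apply/decreasing_seqP => n; rewrite !affine_branch1; exact: points_gt.
  + under eq_fun do rewrite affine_branch1; exact: points_cvg.
(* Single branches already contract uniformly, so [m = 1]. *)
- have [r /andP[_ r1] slope_le] := slope_contract _ _ Pa.
  exists 1%N, r; split=> // -[[|i []]] //= _ x _.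
  rewrite -[_ \o _]/(affine_branch a i) derive1_affine_branch ger0_norm//.
  exact/ltW/slope_gt0.
- by move=> i x; rewrite in_itv/=; exact: affine_mapK.
- exact: affine_map0.
- by move=> _; exact: affine_map1.
Qed.

Lemma potential_affine_branch {R : realType} {a : nat -> R} s :
  partition_points a ->
  potential (affine_branch a) s = ln (a (s 0%N) - a (s 0%N).+1).
Proof.
move=> Pa; rewrite /potential derive01_affine_branch; last exact: coding_itv.
by rewrite ger0_norm// ltW// slope_gt0.
Qed.

Lemma affine_potential_finite {R : realType} {a : nat -> R} :
  partition_points a -> potential_finite (affine_branch a).
Proof.
move=> Pa s; rewrite derive01_affine_branch; last exact: coding_itv.
by rewrite gt_eqF// slope_gt0.
Qed.

Lemma symbolic_var0 {R : realType} (phi : (nat -> nat) -> R) (F : nat -> R) n :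
  (0 < n)%N -> (forall s, phi s = F (s 0%N)) -> symbolic_var n phi = 0%E.
Proof.
case: n => // n _ phiE; apply/eqP; rewrite eq_le; apply/andP; split.
- apply: ge_ereal_sup => _ [w _ <-]; apply: ge_ereal_sup => _ [[s t] [/= ws wt] <-].
  rewrite !phiE; have -> : s 0%N = t 0%N.
    by have := etrans ws (esym wt); rewrite size_tuple => -[].
  by rewrite subrr normr0.
(* An empty extended supremum is minus infinity, so the lower bound 0 needs an actual point in an
   actual cylinder. *)
- pose z : nat -> nat := fun=> 0%N.
  apply: (@le_trans _ _ (ereal_sup [set `|phi p.1 - phi p.2|%:E
      | p in cylinder (mkseq z n.+1) `*` cylinder (mkseq z n.+1)])).
    apply: ereal_sup_ubound; exists (z, z); last by rewrite subrr normr0.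
    by split; rewrite /cylinder /= size_map size_iota.
  by apply: ereal_sup_ubound; exists [tuple of mkseq z n.+1].
Qed.

Lemma affine_var_sum {R : realType} {a : nat -> R} : partition_points a ->
  symbolic_var_sum (potential (affine_branch a)) = 0%E.
Proof.
move=> Pa; apply: eseries0 => n n1 _.
apply: (symbolic_var0 _ (fun i => ln (a i - a i.+1))) => // s.
exact: potential_affine_branch.
Qed.

Lemma measure_affine_branch {R : realType} {a : nat -> R} i : partition_points a ->
  lebesgue_measure (affine_branch a i @` `[0%R, 1%R]) = (a i - a i.+1)%:E.
Proof.
move=> Pa; have s0 := slope_gt0 _ _ Pa i.
have -> : affine_branch a i @` `[0%R, 1%R] = `[a i.+1, a i]%classic.
  apply/seteqP; split=> [_ [x /= + <-]|y /=]; rewrite !in_itv/= => /andP[y0 y1].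
    rewrite affine_branch_ge//= -[leRHS](affine_branch1 _ a i).
    by rewrite affine_branch_mono.
  exists ((y - a i.+1) / (a i - a i.+1)).
    rewrite /= in_itv/=; apply/andP; split.
      by apply: divr_ge0; [rewrite subr_ge0|exact: ltW].
    by rewrite ler_pdivrMr// mul1r lerD2r.
  by rewrite /affine_branch mulrCA divff ?gt_eqF// mulr1 addrC subrK.
by rewrite lebesgue_measure_itv/= lte_fin (points_gt _ Pa).
Qed.

(** * Bounds on the Hoelder exponent *)

Section HolderExponent.
Variables (R : realType) (a b : nat -> R).
Hypotheses (Pa : partition_points a) (Pb : partition_points b).

(** The exponent 0 is admissible with [C = 1]: values lie in [0,1], and the power 0 equals 1 even
    when [x = y]. *)
Lemma holder_exponent_ge0 : (0 <= holder_exponent (transfer a b))%E.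
Proof.
apply: ereal_sup_ubound; exists 0 => //; split=> //; exists 1 => // x y.
rewrite !in_itv/= => /andP[x0 _] /andP[y0 _]; rewrite powRr0 mulr1.
have /andP[tx0 tx1] := transfer_itv _ a b Pb _ x0.
have /andP[ty0 ty1] := transfer_itv _ a b Pb _ y0.
by rewrite ler_norml; apply/andP; split; lra.
Qed.

(* On the cylinders of the words [i^n] the transfer map takes intervals of
   length about [p ^ (m n)] to intervals of length about [p ^ n]. *)
Lemma holder_exponent_le i m : (0 < m)%N ->
  a i - a i.+1 = (b i - b i.+1) ^+ m ->
  (holder_exponent (transfer a b) <= (m%:R^-1)%:E)%E.
Proof.
set p := b i - b i.+1 => m0 slope_a.
have p0 : 0 < p := slope_gt0 _ _ Pb i.
have p1 : p < 1.
  by have [r /andP[_ r1] le_r] := slope_contract _ _ Pb; exact: le_lt_trans (le_r i) r1.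
apply: ge_ereal_sup => _ [kappa [kappa0 [C C0 holder]] <-].
rewrite lee_fin leNgt; apply/negP => m_kappa.
have {}m_kappa : 1 < m%:R * kappa.
  by rewrite -ltr_pdivrMl ?mulr1 ?ltr0n.
(* [r] is the ratio left after dividing [p ^ (m n kappa)] by [p ^ n]; it is below 1 exactly because
   [kappa] exceeds [1 / m]. *)
pose r := p `^ (m%:R * kappa - 1).
have r0 : 0 < r by exact: powR_gt0.
have r1 : r < 1.
  have <- : 1 `^ (m%:R * kappa - 1) = 1 :> R by rewrite powR1.
  apply: gt0_ltr_powR => //.
  - by rewrite subr_gt0.
  - by rewrite nnegrE ltW.
  - by rewrite nnegrE ler01.
(* The Hoelder bound is tested on the endpoints of [i^n 0] and [i^n], at distance [p ^ (m n) * a 1],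
   with images at distance [p ^ n * b 1]. As [n] grows the right side tends to 0, a
   contradiction. *)
have bound n : b 1%N <= C * r ^+ n.
  have := holder (word_point a (nseq n i ++ [:: 0%N])) (word_point a (nseq n i)).
  rewrite !in_itv/=.
  have /andP[-> /ltW ->] := word_point_itv _ _ Pa (nseq n i ++ [:: 0%N]).
  have /andP[-> /ltW ->] := word_point_itv _ _ Pa (nseq n i).
  move=> /(_ isT isT); rewrite !transfer_word_point// !word_point_nseq -/p slope_a.
  rewrite /word_point/= !affine_branch0.
  have b1 := points_gt0 _ _ Pb 1; have a1 := points_gt0 _ _ Pa 1.
  have pn0 : 0 < p ^+ n by exact: exprn_gt0.
  have pmn0 : 0 < (p ^+ m) ^+ n by rewrite !exprn_gt0.
  rewrite (gtr0_norm (mulr_gt0 pn0 b1)) (gtr0_norm (mulr_gt0 pmn0 a1)) => h.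
  rewrite -(ler_pM2l pn0) mulrCA (le_trans h)// ler_pM2l//.
  have -> : p ^+ n * r ^+ n = ((p ^+ m) ^+ n) `^ kappa.
    rewrite -exprMn mulr_powRB1 ?(ltW p0) ?(lt_trans ltr01)//.
    rewrite -exprM -(powR_mulrn (m * n) (ltW p0)) -(powR_mulrn n (powR_ge0 _ _)).
    by rewrite -!powRrM natrM mulrAC.
  apply: ge0_ler_powR => //.
  - by rewrite nnegrE ltW// mulr_gt0.
  - by rewrite nnegrE ltW.
  by rewrite ger_pMr// points_le1.
have : \forall n \near \oo, C * r ^+ n < b 1%N.
  have cvg0 : C * r ^+ n @[n --> \oo] --> C * 0.
    by apply: cvgMr; apply: cvg_expr; rewrite gtr0_norm.
  by apply: (cvgr_lt _ cvg0); rewrite mulr0 points_gt0.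
by case=> N _ /(_ N (leqnn N)) /=; rewrite ltNge bound.
Qed.

End HolderExponent.

(** * The dyadic partition and its perturbations *)

Definition dyadic (R : realType) (n : nat) : R := 2^-1 ^+ n.

(* Moves the single breakpoint [k + 1] down, so that the branch [k + 1] has
   slope [2 ^ - (k + 2) (k + 1)] instead of [2 ^ - (k + 2)]. *)
Definition perturbed_dyadic (R : realType) (k n : nat) : R :=
  if n == k.+1 then dyadic R k.+2 + dyadic R k.+2 ^+ k.+1 else dyadic R n.

Section Dyadic.
Variable R : realType.
Local Notation dyadic := (dyadic R).
Local Notation perturbed_dyadic := (perturbed_dyadic R).

Lemma dyadic_gt0 n : 0 < dyadic n.
Proof. by rewrite exprn_gt0// invr_gt0. Qed.

Lemma dyadicS n : dyadic n = dyadic n.+1 + dyadic n.+1.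
Proof. by rewrite /dyadic exprS -mulrDl -[X in (X + X) * _]mul1r -splitr mul1r. Qed.

Lemma dyadic_partition : partition_points dyadic.
Proof.
split=> [|n|]; first exact: expr0.
  by rewrite [ltRHS]dyadicS ltrDl dyadic_gt0.
by apply: cvg_expr; rewrite gtr0_norm ?invr_gt0// invf_lt1// ltr1n.
Qed.

Lemma dyadic_slope n : dyadic n - dyadic n.+1 = dyadic n.+1.
Proof. by rewrite [X in X - _]dyadicS addrK. Qed.

Lemma perturbed_dyadic_slope k :
  perturbed_dyadic k k.+1 - perturbed_dyadic k k.+2 =
  (dyadic k.+1 - dyadic k.+2) ^+ k.+1.
Proof.
by rewrite /perturbed_dyadic eqxx eqn_leq ltnn dyadic_slope [X in X - _]addrC addrK.
Qed.

Lemma perturbed_dyadicE k n : n != k.+1 -> perturbed_dyadic k n = dyadic n.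
Proof. by rewrite /perturbed_dyadic => /negbTE ->. Qed.

Lemma perturbed_dyadic_partition k : partition_points (perturbed_dyadic k).
Proof.
have d0 := dyadic_gt0 k.+2.
have q0 : 0 < dyadic k.+2 ^+ k.+1 by rewrite exprn_gt0.
(* Hence the moved breakpoint never rises above its dyadic position; it stays put for [k = 0]. *)
have q1 : dyadic k.+2 ^+ k.+1 <= dyadic k.+2.
  rewrite exprS ger_pMr//; apply: exprn_ile1; first exact: ltW.
  exact: points_le1 dyadic_partition _.
split=> [|n|]; first by rewrite perturbed_dyadicE// (points0 _ dyadic_partition).
- have [-> | nk1] := eqVneq n k.+1.
    rewrite [X in X < _]perturbed_dyadicE ?eqn_leq ?ltnn//.
    by rewrite /perturbed_dyadic eqxx ltrDl.
  rewrite [X in _ < X]perturbed_dyadicE//.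
  have [[->] | nk] := eqVneq n.+1 k.+1.
    rewrite /perturbed_dyadic eqxx; have := dyadicS k; have := dyadicS k.+1; lra.
  by rewrite perturbed_dyadicE// (points_gt _ dyadic_partition).
- have : \forall n \near \oo, dyadic n = perturbed_dyadic k n.
    near=> n; rewrite perturbed_dyadicE// gtn_eqF//.
    by near: n; exists k.+2.
  by move=> /near_eq_cvg /cvg_trans; apply; exact: points_cvg dyadic_partition.
Unshelve. all: by end_near. Qed.

Lemma cvg_perturbed_branch i x :
  affine_branch (perturbed_dyadic k) i x @[k --> \oo] --> affine_branch dyadic i x.
Proof.
apply: cvg_near_cst; near=> k.
(* Branch [i] involves only breakpoints [i] and [i + 1], both below the moved index [k + 1]. *)
have ki : (i < k)%N by near: k; exists i.+1.
by rewrite /affine_branch !perturbed_dyadicE// ltn_eqF// ltnS// ltnW.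
Unshelve. all: by end_near. Qed.

Lemma dyadic_measure_sum (t : R) : 0 < t -> (\sum_(0 <= i <oo)
  (lebesgue_measure (affine_branch dyadic i @` `[0%R, 1%R]) `^ t) < +oo)%E.
Proof.
move=> t0; pose r : R := 2^-1 `^ t.
have half0 : 0 <= 2^-1 :> R by rewrite invr_ge0.
have r0 : 0 <= r by exact: powR_ge0.
have r1 : r < 1.
  have <- : 1 `^ t = 1 :> R by rewrite powR1.
  apply: gt0_ltr_powR => //; rewrite ?nnegrE//.
  by rewrite invf_lt1// ltr1n.
have termE i : (lebesgue_measure (affine_branch dyadic i @` `[0%R, 1%R]) `^ t =
    (r ^+ i.+1)%:E)%E.
  rewrite measure_affine_branch; last exact: dyadic_partition.
  rewrite dyadic_slope poweR_EFin /dyadic /r -!powR_mulrn ?powR_ge0//.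
  by rewrite -!powRrM mulrC.
(* The terms are [r ^ (i + 1)], so the geometric sum from exponent 0 is an upper bound. *)
apply: (@le_lt_trans _ _ (1 - r)^-1%:E); last exact: ltry.
apply: lime_le.
  by apply: is_cvg_nneseries => n _ _; rewrite poweR_ge0.
apply: nearW => n; under eq_bigr do rewrite termE.
rewrite sumEFin lee_fin big_mkord.
under eq_bigr do rewrite exprS.
rewrite -mulr_sumr -[leRHS]mul1r ler_pM ?(ltW r1)//.
  by rewrite sumr_ge0// => i _; rewrite exprn_ge0.
rewrite -[leRHS]mul1r ler_pdivlMr ?subr_gt0//.
by have := subrX1 r n; have : 0 <= r ^+ n by [exact: exprn_ge0]; nra.
Qed.

End Dyadic.

Theorem proposition1p3 (R : realType) :
  exists (o : orientation)
         (T : R -> R) (f : nat -> R -> R)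
         (Tk : nat -> R -> R) (fk : nat -> nat -> R -> R)
         (theta : nat -> R -> R),
    (countable_markov_map o T f /\ potential_finite f) /\
    (forall k, countable_markov_map o (Tk k) (fk k) /\
               potential_finite (fk k)) /\
    summable_variations (potential f) /\
    (exists t : R, 0 < t < 1 /\
      (\sum_(0 <= i <oo) (lebesgue_measure (f i @` `[0%R, 1%R]) `^ t) < +oo)%E) /\
    (ereal_sup (range (fun k => symbolic_var_sum (potential (fk k)))) < +oo)%E /\
    (forall i (x : R), x \in `[0, 1] -> (fun k => fk k i x) @ \oo --> f i x) /\
    (forall k, conjugacy (Tk k) (fk k) T f (theta k)) /\
    (fun k => holder_exponent (theta k)) @ \oo --> (0 : \bar R)%E.
Proof.
have P := dyadic_partition R; have Pk := perturbed_dyadic_partition R.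
exists Increasing, (affine_map (dyadic R)), (affine_branch (dyadic R)),
  (fun k => affine_map (perturbed_dyadic R k)),
  (fun k => affine_branch (perturbed_dyadic R k)),
  (fun k => transfer (perturbed_dyadic R k) (dyadic R)).
split; first by split; [exact: affine_markov_map|exact: affine_potential_finite].
split.
  by move=> k; split; [exact: affine_markov_map|exact: affine_potential_finite].
split; first by rewrite /summable_variations affine_var_sum.
split.
  have half01 : 0 < (2^-1 : R) < 1 by rewrite invr_gt0 invf_lt1 ?ltr0n ?ltr1n.
  by exists 2^-1; split=> //; apply: dyadic_measure_sum; case/andP: half01.
split.
  apply: (@le_lt_trans _ _ 0%E) => //.
  by apply: ge_ereal_sup => _ [k _ <-]; rewrite affine_var_sum.
split; first by move=> i x _; exact: cvg_perturbed_branch.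
split; first by move=> k; exact: transfer_conjugacy.
(* The exponent lies between 0 and [1 / (k + 1)], by comparing the slopes of branch [k + 1]. *)
apply: squeeze_cvge (cvg_cst _) (cvge_harmonic); apply: nearW => k.
rewrite holder_exponent_ge0//=; apply: (holder_exponent_le _ _ _ _ _ k.+1) => //.
exact: perturbed_dyadic_slope.
Qed.
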